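(* Let $n>2$ be any integer. Then there are finite quasisimple groups $G$ of arbitrarily large order such that $x^ny^n$ is not surjective on $G$; that is, the map $G\times G\to G$, $(x,y)\mapsto x^ny^n$, is not surjective.
   Context: A finite group $G$ is quasisimple if $G$ is perfect and $G/Z(G)$ is a (non-abelian) simple group. *)

(* Defs.v *)
(* Mathematical Components. *)
From mathcomp Require Import all_boot all_fingroup all_solvable.

Set Implicit Arguments.
Unset Strict Implicit.
Unset Printing Implicit Defensive.

Local Open Scope group_scope.

Definition perfect (gT : finGroupType) (G : {group gT}) : bool :=
  [~: G, G] == G.

(* In the library, [simple] also holds of the cyclic groups of prime order. *)
Definition quasisimple (gT : finGroupType) (G : {group gT}) : bool :=
  [&& perfect G, simple (G / 'Z(G)) & ~~ abelian (G / 'Z(G))].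

Definition power_map (gT : finGroupType) (n : nat) (x y : gT) : gT :=
  x ^+ n * y ^+ n.

Definition power_map_surjective
    (gT : finGroupType) (G : {group gT}) (n : nat) : Prop :=
  forall g, g \in G ->
    exists x y, [/\ x \in G, y \in G & power_map n x y = g].

(* Main.v *)
(* Some d, an odd prime or 4, divides n; let p be the prime dividing d. If G is
   a group all of whose p-elements x satisfy x^d = 1, then every n-th power in G
   is a p'-element. Hence a central p-element z <> 1 is not of the form x^n y^n:
   x^n = z y^-n is a p'-element, while its p-part is z.

   Such a G is SL_p(F_q), realised as the group generated by all transvections.
   For p odd, take p | q - 1 but not p^2 | q - 1, which is the case for infinitely
   many powers q of a suitable prime divisor of p + 1. If a p-element X of SL_p(F_q)
   had order p^2, its characteristic polynomial would have a common factor with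
   some t^p - b, b a primitive p-th root of unity; the latter is irreducible, so
   both polynomials are equal and det X = b <> 1. For p = 2, take q an odd power of
   3: then X^4 + 1 = (tr(X)^2 - 2) X^2 on SL_2(F_q) and 2 is not a square, so
   X^8 = 1 implies X^4 = 1.

   Quasisimplicity is Iwasawa's argument: a non-central normal subgroup N is
   transitive on lines, so every transvection is conjugate under N into the abelian
   group A of transvections along one fixed line; thus G = NA and G = G' <= N. *)
Require Import Defs.
From mathcomp Require Import all_boot all_fingroup all_solvable.
From mathcomp Require Import all_algebra all_field.
From mathcomp Require Import ring zify.

Set Implicit Arguments.
Unset Strict Implicit.
Unset Printing Implicit Defensive.

Import GRing.Theory.
Local Open Scope ring_scope.

(** * The group generated by transvections *)

Section Transvections.

Variables (F : finFieldType) (k : nat).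
Local Notation m := k.+2.
Implicit Types (u v w : 'rV[F]_m) (f : 'cV[F]_m) (g : {'GL_m[F]}).

(* [GLval] has type ['M[F]_m.-1.+1] over another path to the ring structure of
   [F]; this copy keeps the sizes and structures of matrix products aligned. *)
Definition matrix_of g : 'M[F]_m := GLval g.

Lemma matrix_of_inj : injective matrix_of.
Proof. exact: val_inj. Qed.

Lemma matrix_of1 : matrix_of 1%g = 1%:M.
Proof. by []. Qed.

Lemma matrix_ofM g h : matrix_of (g * h)%g = matrix_of g *m matrix_of h.
Proof. by []. Qed.

Lemma matrix_ofJ g h :
  matrix_of (g ^ h)%g = matrix_of h^-1 *m matrix_of g *m matrix_of h.
Proof. by rewrite /conjg !matrix_ofM mulmxA. Qed.

Definition transvection f u : 'M[F]_m := 1%:M + f *m u.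

(** The identity is included, since [f] or [u] may be 0. *)
Definition transvections : {set {'GL_m[F]}} :=
  [set g : {'GL_m[F]} | [exists f, exists u,
    (u *m f == 0) && (matrix_of g == transvection f u)]].

Definition transvection_group : {group {'GL_m[F]}} := <<transvections>>%G.
Local Notation G := transvection_group.

(* Lets membership in [G] be used for matrices not yet known to be invertible. *)
Definition in_group (M : 'M[F]_m) := exists2 g, g \in G & matrix_of g = M.

Lemma mul_transvection f u w :
  u *m f = 0 -> transvection f u *m transvection f w = transvection f (u + w).
Proof.
move=> uf0; rewrite /transvection mulmxDl mul1mx !mulmxDr mulmx1 mulmxA.
by rewrite -(mulmxA f u) uf0 mulmx0 mul0mx addr0 addrAC addrA.
Qed.

Lemma mul_transvection_col f h u :
  u *m h = 0 -> transvection f u *m transvection h u = transvection (f + h) u.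
Proof.
move=> uh0; rewrite /transvection mulmxDl mul1mx !mulmxDr mulmx1 mulmxA.
rewrite -(mulmxA f u) uh0 mulmx0 mul0mx addr0 mulmxDl.
by rewrite addrAC addrA.
Qed.

Lemma transvectionP f u :
  u *m f = 0 -> exists2 g, g \in transvections & matrix_of g = transvection f u.
Proof.
move=> uf0.
have unitT : transvection f u \in unitmx.
  case: (@mulmx1_unit _ _ (transvection f u) (transvection f (- u))) => //.
  by rewrite mul_transvection // subrr /transvection mulmx0 addr0.
exists (insubd (1%g : {'GL_m[F]}) (transvection f u)); last first.
  by rewrite /matrix_of insubdK.
rewrite inE; apply/existsP; exists f; apply/existsP; exists u.
by rewrite uf0 /matrix_of insubdK ?eqxx.
Qed.

Lemma in_transvections g : g \in transvections ->
  exists (f : 'cV[F]_m) (u : 'rV[F]_m), u *m f = 0 /\ matrix_of g = transvection f u.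
Proof.
by rewrite inE => /existsP[f /existsP[u /andP[/eqP uf /eqP gE]]]; exists f, u.
Qed.

Lemma in_group_transvection f u :
  u *m f = 0 -> in_group (transvection f u).
Proof.
by case/transvectionP=> g gT gE; exists g => //; apply: mem_gen.
Qed.

Lemma in_groupM (M N : 'M[F]_m) :
  in_group M -> in_group N -> in_group (M *m N).
Proof.
by move=> [g gG <-] [h hG <-]; exists (g * h)%g; rewrite ?groupM ?matrix_ofM.
Qed.

Lemma act_transvection f u v :
  v *m transvection f u = v + (v *m f) *m u.
Proof. by rewrite mulmxDr mulmx1 mulmxA. Qed.

Lemma transvection_conj g f u :
  matrix_of g^-1 *m transvection f u *m matrix_of g =
  transvection (matrix_of g^-1 *m f) (u *m matrix_of g).
Proof.
rewrite /transvection mulmxDr mulmx1 mulmxDl -matrix_ofM mulVg matrix_of1.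
by rewrite !mulmxA.
Qed.

(** * Transitivity on vectors and on lines *)

(** The columns of the cokernel of [A] are functionals vanishing on [A]; one of them is nonzero on
    [v] and can be normalised. *)
Lemma separating_functional r (A : 'M[F]_(r, m)) v :
  ~~ (v <= A)%MS -> exists f : 'cV[F]_m, A *m f = 0 /\ v *m f = 1%:M.
Proof.
rewrite submxE; move: (cokermx A) (mulmx_coker A) => C AC0 /rV0Pn[j cj].
exists (((v *m C) 0 j)^-1 *: col j C); rewrite -!scalemxAr colE !mulmxA AC0.
rewrite mul0mx scaler0 -colE; split=> //; apply/matrixP=> a b.
by rewrite !ord1 [LHS]mxE [RHS]mxE [X in _ * X]mxE mulVf.
Qed.

Lemma vector_outside_line v : exists w, ~~ (w <= v)%MS.
Proof.
have: ~~ (1%:M <= v)%MS.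
  by rewrite sub1mx /row_full ltn_eqF // ltnS (leq_trans (rank_leq_row _)).
by case/row_subPn=> i; exists (row i 1%:M).
Qed.

Lemma transvection_move v w : v != 0 -> ~~ (w <= v)%MS ->
  exists2 M, in_group M & v *m M = w.
Proof.
move=> v0 wv.
have: ~~ (v <= w - v)%MS.
  apply: contra wv => /sub_rVP[a va].
  have a0: a != 0 by apply: contraNneq v0 => a0; rewrite va a0 scale0r.
  apply/sub_rVP; exists (a^-1 + 1).
  by rewrite scalerDl scale1r {1}va scalerA mulVf // scale1r subrK.
(* [f] kills [w - v] and is 1 on [v], so [v] goes to [v + (w - v)]. *)
case/separating_functional=> f [wf vf].
exists (transvection f (w - v)); first exact: in_group_transvection.
by rewrite act_transvection vf mul1mx addrC subrK.
Qed.

Lemma transitive_vectors v w : v != 0 -> w != 0 ->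
  exists2 M, in_group M & v *m M = w.
Proof.
move=> v0 w0; have [/sub_rVP[a wav]|] := boolP (w <= v)%MS; last first.
  exact: transvection_move.
have a0: a != 0 by apply: contraNneq w0 => a0; rewrite wav a0 scale0r.
have [x xv] := vector_outside_line v.
have [M1 M1G e1] := transvection_move v0 xv.
have [||M2 M2G e2] := @transvection_move x w.
- by apply: contraNneq xv => ->; rewrite sub0mx.
- apply: contra xv => /sub_rVP[b wb].
  have b0: b != 0 by apply: contraNneq w0 => b0; rewrite wb b0 scale0r.
  apply/sub_rVP; exists (b^-1 * a).
  by rewrite -scalerA -wav wb scalerA mulVf // scale1r.
by exists (M1 *m M2); [apply: in_groupM | rewrite mulmxA e1].
Qed.

Lemma transitive_lines_stab w (x y : 'rV[F]_m) :
  ~~ (x <= w)%MS -> ~~ (y <= w)%MS ->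
  exists (M : 'M[F]_m) (c : F),
    [/\ in_group M, c != 0, w *m M = w & x *m M = c *: y].
Proof.
move=> xw yw.
have [sx|] := boolP (x <= col_mx w (y - x))%MS; last first.
  case/separating_functional=> f [/eqP]; rewrite mul_col_mx.
  rewrite -[0]vsubmxK => /eqP/eq_col_mx[]; rewrite !linear0 => wf yxf xf.
  exists (transvection f (y - x)), 1; split; rewrite ?oner_eq0 //.
  - exact: in_group_transvection.
  - by rewrite act_transvection wf mul0mx addr0.
  - by rewrite act_transvection xf mul1mx scale1r addrC subrK.
(* Here [(1 + b) x = a w + b y], so subtracting [a / (1 + b)] times [w] from [x] lands on the line
   of [y]. *)
have [a [b xE]] : exists a, exists b, x = a *: w + b *: (y - x).
  case/submxP: sx => D; rewrite -[D]hsubmxK mul_row_col.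
  rewrite (mx11_scalar (lsubmx D)) (mx11_scalar (rsubmx D)) !mul_scalar_mx.
  by move=> xE; do 2!eexists; exact: xE.
have b0: b != 0.
  apply: contraNneq xw => b0; rewrite xE b0 scale0r addr0.
  by apply/sub_rVP; exists a.
have b1: 1 + b != 0.
  apply: contraNneq yw => b1; apply/sub_rVP; exists (- b^-1 * a).
  have: b *: y = - a *: w.
    have: x + b *: x = a *: w + b *: y.
      by rewrite {1}xE scalerBr -!addrA addNr addr0.
    rewrite -{1}[x]scale1r -scalerDl b1 scale0r scaleNr => /eqP.
    by rewrite eq_sym addrC addr_eq0 => /eqP.
  move/(congr1 (GRing.scale b^-1)); rewrite !scalerA mulVf // scale1r => ->.
  by rewrite mulrN mulNr.
have [f [wf xf]] := separating_functional xw.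
exists (transvection f (- (a / (1 + b)) *: w)), (b / (1 + b)).
split; first 1 last.
- by rewrite mulf_neq0 ?invr_eq0.
- by rewrite act_transvection wf mul0mx addr0.
- rewrite act_transvection xf mul1mx scaleNr.
  have key: (1 + b) *: x = a *: w + b *: y.
    by rewrite scalerDl scale1r {1}xE scalerBr addrA subrK.
  apply: (scalerI b1); rewrite scalerBr !scalerA key.
  by rewrite ![(1 + b) * _]mulrC !divfK // addrC addKr.
by apply: in_group_transvection; rewrite -scalemxAl wf scaler0.
Qed.

(** * The copy of SL_2 on a plane *)

(** When [Q P = 1], this acts as [M] on the row space of [Q] and trivially on its complement, the
    kernel of [P]. *)
Definition plane_embedding (P : 'M[F]_(m, 1 + 1)) (Q : 'M[F]_(1 + 1, m))
  (M : 'M[F]_(1 + 1)) : 'M[F]_m := 1%:M + P *m (M - 1%:M) *m Q.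

Lemma plane_embeddingM P Q M N : Q *m P = 1%:M ->
  plane_embedding P Q (M *m N) =
  plane_embedding P Q M *m plane_embedding P Q N.
Proof.
move=> QP; rewrite /plane_embedding.
have -> : M *m N - 1%:M = (M - 1%:M) + (N - 1%:M) + (M - 1%:M) *m (N - 1%:M).
  rewrite mulmxBl !mulmxBr !mul1mx !mulmx1 -addrA.
  by rewrite [N - _ + _]addrC subrK addrC addrA subrK.
move: (M - _) (N - _) => {}M {}N.
rewrite !mulmxDr !mulmxDl !mul1mx mulmx1 -!addrA; congr (_ + (_ + (_ + _))).
by rewrite !mulmxA -(mulmxA (P *m _) Q P) QP mulmx1.
Qed.

Definition mx2 (a b c d : F) : 'M[F]_(1 + 1) :=
  block_mx a%:M b%:M c%:M d%:M.

Lemma mul_mx2 a b c d a' b' c' d' :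
  mx2 a b c d *m mx2 a' b' c' d' =
  mx2 (a * a' + b * c') (a * b' + b * d') (c * a' + d * c') (c * b' + d * d').
Proof. by rewrite /mx2 mulmx_block -!scalar_mxM -!raddfD. Qed.

Section Plane.

Variables (f h : 'cV[F]_m) (u w : 'rV[F]_m).
Hypotheses (wf : w *m f = 1%:M) (uh : u *m h = 1%:M).
Hypotheses (uf : u *m f = 0) (wh : w *m h = 0).

Let P : 'M[F]_(m, 1 + 1) := row_mx f h.
Let Q : 'M[F]_(1 + 1, m) := col_mx w u.

Let QP : Q *m P = 1%:M.
Proof. by rewrite mul_col_row wf wh uf uh -scalar_mx_block. Qed.

Let plane_embeddingE a b c d : plane_embedding P Q (mx2 a b c d) =
  1%:M + (f *m ((a - 1) *: w + b *: u) + h *m (c *: w + (d - 1) *: u)).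
Proof.
rewrite /plane_embedding; congr (_ + _).
rewrite /mx2 (scalar_mx_block _ _ 1) opp_block_mx add_block_mx !subr0 -!raddfB.
rewrite mul_row_block mul_row_col !mul_mx_scalar !mulmxDl !mulmxDr.
rewrite -!scalemxAl -!scalemxAr.
by rewrite -!addrA; congr (_ + _); rewrite addrCA.
Qed.

Lemma in_group_diag (a : F) : a != 0 ->
  in_group (1%:M + (a - 1) *: (f *m w) + (a^-1 - 1) *: (h *m u)).
Proof.
move=> a0.
have upper b : in_group (plane_embedding P Q (mx2 1 b 0 1)).
  rewrite plane_embeddingE subrr !scale0r add0r addr0 mulmx0 addr0.
  by apply: in_group_transvection; rewrite -scalemxAl uf scaler0.
have lower b : in_group (plane_embedding P Q (mx2 1 0 b 1)).
  rewrite plane_embeddingE subrr !scale0r !addr0 mulmx0 add0r.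
  by apply: in_group_transvection; rewrite -scalemxAl wh scaler0.
have: in_group (plane_embedding P Q (mx2 a 0 0 a^-1)).
  (* The classical factorisation into elementary matrices of SL_2. *)
  have -> : mx2 a 0 0 a^-1 = mx2 1 0 (a^-1) 1 *m mx2 1 (1 - a) 0 1 *m
                             mx2 1 0 (- 1) 1 *m mx2 1 (1 - a^-1) 0 1.
    rewrite !mul_mx2.
    by congr mx2; field.
  by rewrite !plane_embeddingM //; do !apply: in_groupM.
by rewrite plane_embeddingE !scale0r addr0 add0r -!scalemxAr addrA.
Qed.

End Plane.

(* If H f = a f and u H = a^-1 u, then H conjugates 1 + f u to 1 + a^-2 f u. *)
Lemma transvection_in_der1 (a : F) g :
  a != 0 -> a ^+ 2 != 1 -> g \in transvections -> g \in [~: G, G]%g.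
Proof.
move=> a0 a1; case/in_transvections=> [f [u [uf gE]]].
have [f0|/cV0Pn[j fj]] := eqVneq f 0.
  suff -> : g = 1%g by apply: group1.
  by apply: matrix_of_inj; rewrite matrix_of1 gE f0 /transvection mul0mx addr0.
have [u0|u0] := eqVneq u 0.
  suff -> : g = 1%g by apply: group1.
  by apply: matrix_of_inj; rewrite matrix_of1 gE u0 /transvection mulmx0 addr0.
pose w : 'rV[F]_m := (f j 0)^-1 *: delta_mx 0 j.
have wf : w *m f = 1%:M.
  rewrite -scalemxAl -rowE; apply/matrixP=> x y.
  by rewrite !ord1 [LHS]mxE [RHS]mxE [X in _ * X]mxE mulVf.
have: ~~ (u <= w)%MS.
  apply: contraNN u0 => /sub_rVP[c uE]; move: uf.
  rewrite uE -scalemxAl wf => /(congr1 (fun A : 'M_1 => A 0 0)).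
  by rewrite !mxE mulr1 => ->; rewrite scale0r.
case/separating_functional=> h [wh uh].
have [H HG HE] := in_group_diag wf uh uf wh a0.
have Hf : matrix_of H *m f = a *: f.
  rewrite HE !mulmxDl -!scalemxAl mul1mx -!mulmxA wf uf !mulmx1 mulmx0 scaler0.
  by rewrite addr0 scalerBl scale1r addrC subrK.
have uH : u *m matrix_of H = a^-1 *: u.
  rewrite HE !mulmxDr -!scalemxAr mulmx1 !mulmxA uh uf mul1mx mul0mx !scaler0.
  by rewrite addr0 scalerBl scale1r addrC subrK.
have VHf : matrix_of H^-1 *m f = a^-1 *: f.
  apply: (scalerI a0); rewrite scalerA divff // scale1r scalemxAr -Hf mulmxA.
  by rewrite -matrix_ofM mulVg matrix_of1 mul1mx.
have a2 : a ^- 2 - 1 != 0 by rewrite subr_eq0 invr_eq1.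
(* With this [c] the commutator [t^-1 t^H] has coefficient [c (a^-2 - 1) = 1]. *)
pose c := (a ^- 2 - 1)^-1.
have [t tT tE] : exists2 t, t \in transvections & matrix_of t = transvection f (c *: u).
  by apply: transvectionP; rewrite -scalemxAl uf scaler0.
suff -> : g = [~ t, H]%g by apply: mem_commg => //; apply: mem_gen.
apply: (mulgI t); rewrite commgEl mulKVg; apply: matrix_of_inj.
rewrite matrix_ofJ matrix_ofM tE transvection_conj gE VHf -scalemxAl uH.
rewrite mul_transvection -?scalemxAl ?uf ?scaler0 // /transvection.
rewrite -{2}[u]scale1r -scalerDl -scalemxAl !scalerA -!scalemxAr scalerA.
congr (_ + _ *: _); rewrite -[in LHS](mulVf a2) -/c mulrBr mulr1 addrC subrK.
by rewrite mulrCA -expr2 exprVn.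
Qed.

Lemma transvection_group_perfect (a : F) :
  a != 0 -> a ^+ 2 != 1 -> G \subset [~: G, G]%g.
Proof.
move=> a0 a1; rewrite gen_subG; apply/subsetP=> g.
exact: transvection_in_der1 a0 a1.
Qed.

(** By perfectness it is enough that commutators have determinant 1. *)
Lemma det_transvection_group (a : F) g :
  a != 0 -> a ^+ 2 != 1 -> g \in G -> \det (matrix_of g) = 1.
Proof.
move=> a0 a1 /(subsetP (transvection_group_perfect a0 a1)).
pose SL := [set g : {'GL_m[F]} | \det (matrix_of g) == 1].
have SLg : group_set SL.
  apply/group_setP; split=> [|x y]; rewrite !inE; first by rewrite matrix_of1 det1.
  by rewrite matrix_ofM det_mulmx => /eqP-> /eqP->; rewrite mulr1.
suff: [~: G, G]%g \subset Group SLg.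
  by move/subsetP=> sub /sub; rewrite inE => /eqP.
rewrite gen_subG; apply/subsetP=> _ /imset2P[x y _ _ ->]; rewrite inE.
have detV z : \det (matrix_of z^-1) * \det (matrix_of z) = 1.
  by rewrite -det_mulmx -matrix_ofM mulVg matrix_of1 det1.
rewrite commgEl /conjg !matrix_ofM !det_mulmx.
by rewrite mulrCA [X in _ * X]mulrA detV mul1r detV.
Qed.

(** * Normal subgroups and quasisimplicity *)

Lemma scalar_central g (a : F) :
  g \in G -> matrix_of g = a%:M -> g \in 'Z(G)%g.
Proof.
move=> gG ga; apply/centerP; split=> // h _; apply: matrix_of_inj.
by rewrite !matrix_ofM ga scalar_mxC.
Qed.

(** If every vector is an eigenvector, comparing [e_i], [e_j] and [e_i + e_j] shows that the matrix
    is scalar, hence central. *)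
Lemma moved_line g : g \in G -> g \notin 'Z(G)%g ->
  exists v, ~~ (v *m matrix_of g <= v)%MS.
Proof.
move=> gG gZ; apply/existsP; apply: contraNT gZ; rewrite negb_exists.
move/forallP=> fixl; pose M := matrix_of g.
have eig v : exists c, v *m M = c *: v by apply/sub_rVP/negbNE/fixl.
have off i j : i != j -> M i j = 0.
  move=> ij; have [c /rowP/(_ j)] := eig (delta_mx 0 i).
  by rewrite -rowE !mxE eqxx eq_sym (negPf ij) mulr0.
have diag i j : M i i = M j j.
  have [->//|ij] := eqVneq i j.
  have [c /rowP cE] := eig (delta_mx 0 i + delta_mx 0 j).
  move: (cE i) (cE j); rewrite mulmxDl -!rowE !mxE !eqxx /= (eq_sym j i) (negPf ij).
  have ji : j != i by rewrite eq_sym.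
  by rewrite (off _ _ ij) (off _ _ ji) !(addr0, add0r, mulr1) => -> ->.
apply: (@scalar_central _ (M 0 0)) => //; apply/matrixP=> i j; rewrite mxE.
by have [<-|/off->] := eqVneq i j; rewrite ?(diag i 0).
Qed.

(** A non-central element of [N] moves some line, so a conjugate [g ^ h] moves the line of [v].
    Conjugating again by a [t] that fixes [v] brings the image of [v] onto the line of [w]. *)
Lemma normal_transitive_lines (N : {group {'GL_m[F]}}) v w :
  (N <| G)%g -> ~~ (N \subset 'Z(G))%g -> v != 0 -> w != 0 ->
  exists g, exists c : F, [/\ g \in N, c != 0 & v *m matrix_of g = c *: w].
Proof.
case/andP=> sNG nNG /subsetPn[g gN gZ] v0 w0.
have [x xg] := moved_line (subsetP sNG _ gN) gZ.
have x0 : x != 0 by apply: contraNneq xg => ->; rewrite mul0mx.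
have [/sub_rVP[c wE]|wv] := boolP (w <= v)%MS.
  have c0 : c != 0 by apply: contraNneq w0 => c0; rewrite wE c0 scale0r.
  exists 1%g, c^-1; rewrite group1 invr_eq0 c0; split=> //.
  by rewrite matrix_of1 mulmx1 wE scalerA mulVf // scale1r.
have [_ [h hG <-] xh] := transitive_vectors x0 v0.
have cancelV z (y : 'rV[F]_m) : y *m matrix_of z *m matrix_of z^-1 = y.
  by rewrite -mulmxA -matrix_ofM mulgV matrix_of1 mulmx1.
have vV z (y y' : 'rV[F]_m) : y *m matrix_of z = y' -> y' *m matrix_of z^-1 = y.
  by move=> <-; apply: cancelV.
have gh : ~~ (v *m matrix_of (g ^ h)%g <= v)%MS.
  rewrite matrix_ofJ !mulmxA (vV _ _ _ xh) -xh.
  apply: contra xg => /(submxMr (matrix_of h^-1)); by rewrite !cancelV.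
have [_ [c [[t tG <-] c0 vt ght]]] := transitive_lines_stab gh wv.
exists ((g ^ h) ^ t)%g, c; split=> //.
  by rewrite !memJ_norm // (subsetP nNG).
by rewrite matrix_ofJ mulmxA mulmxA (vV _ _ _ vt).
Qed.

Lemma transvection_normal_sub (a : F) (N : {group {'GL_m[F]}}) :
  a != 0 -> a ^+ 2 != 1 ->
  (N <| G)%g -> ~~ (N \subset 'Z(G))%g -> G \subset N.
Proof.
move=> a0 a1 nN nZ; have [sNG nNG] := andP nN.
pose u0 : 'rV[F]_m := delta_mx 0 0.
have u00 : u0 != 0 by apply/rV0Pn; exists 0; rewrite mxE !eqxx oner_eq0.
pose A := [set g : {'GL_m[F]} |
  [exists f : 'cV[F]_m, (u0 *m f == 0) && (matrix_of g == transvection f u0)]].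
have cA : abelian A.
  apply/centsP=> x; rewrite inE => /existsP[f /andP[/eqP uf /eqP xE]] y.
  rewrite inE => /existsP[h /andP[/eqP uh /eqP yE]]; apply: matrix_of_inj.
  by rewrite !matrix_ofM xE yE !mul_transvection_col // addrC.
have sAG : A \subset G.
  apply/subsetP=> x; rewrite inE => /existsP[f fP]; apply: mem_gen.
  by rewrite inE; apply/existsP; exists f; apply/existsP; exists u0.
have sG : G \subset (N <*> A)%g.
  rewrite gen_subG; apply/subsetP=> t /in_transvections[f [u [uf tE]]].
  have [u_0|un0] := eqVneq u 0.
    suff -> : t = 1%g by apply: group1.
    by apply: matrix_of_inj; rewrite matrix_of1 tE u_0 /transvection mulmx0 addr0.
  (* Conjugation by [g] turns the direction [u] of [t] into that of [u0], which puts [t] in [A]. *)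
  have [g [c [gN c0 ug]]] := normal_transitive_lines nN nZ un0 u00.
  have gNA : g \in (N <*> A)%g by apply: (subsetP (joing_subl _ _)).
  rewrite -(groupJr t gNA); apply: (subsetP (joing_subr N A)).
  rewrite inE; apply/existsP; exists (c *: (matrix_of g^-1 *m f)).
  apply/andP; split.
    rewrite -scalemxAr scalemxAl -ug mulmxA -(mulmxA u) -matrix_ofM.
    by rewrite mulgV matrix_of1 mulmx1 uf.
  by rewrite matrix_ofJ tE transvection_conj ug /transvection -scalemxAr scalemxAl.
(* [G / N] is an image of the abelian group [<<A>>], so the derived group lies in [N]. *)
apply: subset_trans (transvection_group_perfect a0 a1) _; rewrite -derg1.
apply: der1_min => //; have nA : <<A>>%g \subset 'N(N)%g.
  by rewrite gen_subG (subset_trans sAG).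
apply: abelianS (quotientS N sG) _.
by rewrite -joing_idr quotientYidl // quotient_abelian // abelian_gen.
Qed.

(** The transvections [1 + b e_1 e_0] are told apart by their entry [b]. This makes the orders
    unbounded. *)
Lemma card_transvection_group : (#|F| <= #|G|)%N.
Proof.
apply: leq_trans (leq_imset_card (fun g => matrix_of g 1 0) G).
rewrite -cardsT; apply/subset_leq_card/subsetP=> b _; apply/imsetP.
have [|g gG gE] := @in_group_transvection (delta_mx 1 0) (b *: delta_mx 0 0).
  by rewrite -scalemxAl mul_delta_mx_0 ?scaler0.
exists g => //; rewrite gE /transvection -scalemxAr mul_delta_mx !mxE /=.
by rewrite add0r mulr1.
Qed.

Lemma transvection_group_quasisimple (a : F) :
  a != 0 -> a ^+ 2 != 1 -> quasisimple G.
Proof.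
move=> a0 a1; have sGG := transvection_group_perfect a0 a1.
have nZG : ('Z(G) <| G)%g := center_normal G.
(* Otherwise [G = G' <= Z(G)], so [G] is abelian and [G = G' = 1]. *)
have nab : ~~ abelian (G / 'Z(G))%g.
  apply/negP=> /(der1_min (normal_norm nZG)); rewrite derg1.
  move/(subset_trans sGG) => /subset_trans/(_ (subsetIr _ _)) /commG1P G1.
  have: (#|F| <= 1)%N.
    apply: leq_trans card_transvection_group _.
    by rewrite -trivg_card_le1 -subG1 -G1.
  by rewrite leqNgt -cardsT (cardD1 0) (cardD1 1) !inE oner_eq0.
have propZ : 'Z(G)%g \proper G.
  rewrite properE center_sub; apply: contra nab => sGZ.
  by rewrite quotientS1 ?abelian1.
apply/and3P; split=> //.
  by rewrite /perfect eqEsubset sGG -derg1 der_sub.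
rewrite quotient_simple //; apply/maxgroupP; rewrite propZ normal_norm //.
split=> // H /andP[pH nH] sZH; apply/eqP; rewrite eqEsubset sZH andbT.
apply: contraTT pH => nHZ; rewrite properE negb_and negbK.
have [sHG|//] := boolP (H \subset G).
by rewrite (transvection_normal_sub a0 a1) // /normal sHG.
Qed.

(** * Scalar matrices in the group *)

Lemma in_group1 : in_group 1%:M.
Proof. by exists 1%g; rewrite ?group1 ?matrix_of1. Qed.

Lemma in_group_diag_pair (i j : 'I_m) (a : F) : i != j -> a != 0 ->
  in_group (diag_mx (\row_l if l == i then a else if l == j then a^-1 else 1)).
Proof.
move=> ij a0; have ji : j != i by rewrite eq_sym.
have := @in_group_diag (delta_mx i 0) (delta_mx j 0)
                       (delta_mx 0 j) (delta_mx 0 i) _ _ _ _ a a0.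
have delta11 : delta_mx 0 0 = 1%:M :> 'M[F]_1.
  by apply/matrixP=> x y; rewrite !ord1 !mxE !eqxx.
rewrite !mul_delta_mx !mul_delta_mx_0 // delta11.
move/(_ erefl erefl erefl erefl); congr in_group; apply/matrixP=> x y.
rewrite !mxE; have [<-|xy] := eqVneq x y.
  rewrite !andbb mulr1n; have [->|xi] := eqVneq x i.
    by rewrite (negPf ij) mulr0 addr0 mulr1 addrC subrK.
  have [_|xj] := eqVneq x j; last by rewrite !mulr0 !addr0.
  by rewrite mulr0 addr0 mulr1 addrC subrK.
have aux l : (x == l) && (y == l) = false.
  by apply: contraNF xy => /andP[/eqP-> /eqP->].
by rewrite !aux mulr0n !mulr0 !addr0.
Qed.

(* Whitehead: z.1 is the product over r of the diagonal matrices with entries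
   z^(r+1), z^-(r+1) at r, r+1. *)
Lemma in_group_scalar (z : F) : z ^+ m = 1 -> in_group z%:M.
Proof.
move=> zm; have z0 : z != 0.
  by apply: contra_eqN zm => /eqP->; rewrite expr0n eq_sym oner_eq0.
have partial r : (r < m)%N -> in_group (diag_mx
    (\row_(l < m) if (l < r)%N then z else if l == r :> nat then z ^- r else 1)).
  elim: r => [|r IHr] ltr.
    rewrite (_ : diag_mx _ = 1%:M); first exact: in_group1.
    apply/matrixP=> i j; rewrite !mxE ltn0 expr0 invr1.
    by case: (i == j); case: ifP.
  have ri : Ordinal (ltnW ltr) != Ordinal ltr by rewrite -val_eqE /= ltn_eqF.
  have := in_groupM (IHr (ltnW ltr))
    (in_group_diag_pair ri (expf_neq0 r.+1 z0)).
  rewrite mulmx_diag; congr in_group; congr diag_mx.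
  apply/rowP=> l; rewrite !mxE -!val_eqE /= ltnS [(l <= r)%N]leq_eqVlt.
  case: (ltngtP l r) => [lr|lr|->]; rewrite ?mulr1 //=.
  - by rewrite ltn_eqF ?mulr1 // ltnW.
  - by rewrite mul1r.
  - by rewrite exprSr mulrA mulVf ?mul1r // expf_neq0.
(* The last entry is [z^-(k+1)], which is [z] because [z^(k+2) = 1]. *)
have:= partial k.+1 (ltnSn _); congr in_group; apply/matrixP=> i j; rewrite !mxE.
have [->|_] := eqVneq i j; last by rewrite !mulr0n.
have:= ltn_ord j; rewrite ltnS leq_eqVlt => /orP[/eqP->|->//].
by rewrite ltnn eqxx; congr (_ *+ _); apply: (mulfI (expf_neq0 k.+1 z0));
   rewrite divff ?expf_neq0 // -exprSr zm.
Qed.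

End Transvections.

(** * Power maps and p-elements *)

Section PowerMap.

Variables (gT : finGroupType) (G : {group gT}) (p : nat).

(** If [x] has order [p^e], start from [x^(p^e d) = 1] and remove one factor [p] at a time, applying
    the hypothesis to powers of [x]. *)
Lemma p_elt_expg_eq1 d :
  (forall x, x \in G -> x ^+ (p * d) = 1 -> x ^+ d = 1)%g ->
  forall x, x \in G -> p.-elt%g x -> (x ^+ d = 1)%g.
Proof.
move=> step x xG px.
have [e oe] := p_natP px.
have: (x ^+ (p ^ e * d) = 1)%g by rewrite expgM -oe expg_order expg1n.
elim: e x xG {px oe} => [|e IHe] x xG; first by rewrite expn0 mul1n.
rewrite expnSr -mulnA expgM => /step; rewrite groupX // -expgM => /(_ isT).
exact: IHe.
Qed.

Lemma power_map_not_surjective d n z :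
  (forall x, x \in G -> p.-elt%g x -> x ^+ d = 1)%g -> (d %| n)%N ->
  z \in 'Z(G)%g -> p.-elt%g z -> z != 1%g -> ~ power_map_surjective G n.
Proof.
move=> Gd /dvdnP[r ->] /centerP[zG zC] pz z1 /(_ z zG)[x [y [xG yG xy]]].
have constt1 w : w \in G -> ((w ^+ (r * d)).`_p = 1)%g.
  move=> wG; rewrite consttX mulnC expgM Gd ?expg1n //; last exact: p_elt_constt.
  by rewrite /constt groupX.
case/eqP: z1; rewrite -(constt_p_elt pz).
have: (z * y^-1 ^+ (r * d) = x ^+ (r * d))%g by rewrite -xy expgVn mulgK.
(* Taking p-parts is multiplicative here because [z] is central. *)
move/(congr1 (constt^~ p)); rewrite constt1 // consttM.
  by rewrite constt1 ?groupV // mulg1.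
by apply: zC; rewrite groupX ?groupV.
Qed.

End PowerMap.

(** * Matrices of p-power order and determinant 1 *)

(** If [c^p = b] and [|F| - 1 = s p], then [b^s = c^(s p) = 1], so [p] divides [s] and [p^2] divides
    [|F| - 1]. *)
Lemma prim_root_not_power (F : finFieldType) p (b c : F) :
  p.-primitive_root b -> (p %| #|F|.-1)%N -> ~~ (p ^ 2 %| #|F|.-1)%N ->
  c ^+ p != b.
Proof.
move=> bprim /dvdnP[s sE] np2; apply: contra np2 => /eqP cb.
have p0 := prim_order_gt0 bprim.
have F0 : (0 < #|F|)%N by rewrite -cardsT (cardD1 0) inE.
have c0 : c != 0.
  apply: contra_eqN (prim_expr_order bprim) => /eqP c0.
  by rewrite -cb c0 -exprM expr0n muln_eq0 (gtn_eqF p0) eq_sym oner_eq0.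
have c1 : c ^+ #|F|.-1 = 1.
  by apply: (mulIf c0); rewrite -exprSr prednK // expf_card mul1r.
rewrite sE expnS expn1 dvdn_pmul2r // (prim_order_dvd bprim) -cb -exprM mulnC.
by rewrite -sE c1.
Qed.

Lemma det_mxX (R : comNzRingType) k (M : 'M[R]_k.+1) n :
  \det (M ^+ n) = \det M ^+ n.
Proof.
elim: n => [|n IHn]; first by rewrite !expr0 det1.
by rewrite !exprS det_mulmx IHn.
Qed.

(* If M is the companion matrix of a factor of degree d < p, then M^p = b gives
   (det M)^p = b^d, and b is a p-th power since d is prime to p. *)
Lemma irreducible_Xn_sub_C (F : fieldType) p (b : F) : prime p -> b ^+ p = 1 ->
  (forall c, c ^+ p != b) -> irreducible_poly ('X^p - b%:P).
Proof.
move=> pr_p bp nb; have p0 := prime_gt0 pr_p.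
have szP : size ('X^p - b%:P) = p.+1 by rewrite size_XnsubC.
split=> [|q sq1 qP]; first by rewrite szP ltnS.
have q0 : q != 0.
  by apply: contraTneq qP => ->; rewrite dvd0p -size_poly_eq0 szP.
wlog monq : q sq1 q0 qP / q \is monic => [wlog|].
  have lq : (lead_coef q)^-1 != 0 by rewrite invr_eq0 lead_coef_eq0.
  have eqq : (lead_coef q)^-1 *: q %= q by rewrite eqp_scale.
  rewrite -(eqp_ltrans eqq); apply: wlog.
  - by rewrite (eqp_size eqq).
  - by rewrite scaler_eq0 negb_or lq.
  - by rewrite (eqp_dvdl _ eqq).
  - by rewrite monicE lead_coefZ mulVf // lead_coef_eq0.
rewrite -(dvdp_size_eqp qP) szP eqn_leq -{1}szP dvdp_leq ?monic_neq0 ?monicXnsubC //=.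
have [d dE] : exists d, size q = d.+2.
  move: sq1 q0; rewrite -size_poly_eq0; case: (size q) => [|[|d]] //.
  by exists d.
rewrite dE ltnS leqNgt; apply/negP=> ltdp.
have [M ME] : exists M : 'M[F]_d.+1, char_poly M = q.
  by move: (companionmx q) (companionmxK monq); rewrite dE /= => M; exists M.
have Mp : M ^+ p = b%:M.
  have := Cayley_Hamilton M; rewrite ME => qM0; move: qP => /dvdpP[r rE].
  move/(congr1 (horner_mx M)): rE; rewrite rmorphM /= qM0 mulr0.
  by rewrite rmorphB /= rmorphXn /= horner_mx_X horner_mx_C => /eqP; rewrite subr_eq0 => /eqP.
have detp : (\det M) ^+ p = b ^+ d.+1.
  by rewrite -det_mxX Mp det_scalar.
have cop : coprime d.+1 p by rewrite coprime_sym prime_coprime // gtnNdvd.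
(* Bezout: [km (d + 1) = kn p + 1], so the p-th power of [(det M)^km] is [b^(kn p + 1) = b]. *)
case: (@egcdnP d.+1 p isT) => km kn kE _; rewrite (eqP cop) in kE.
have /eqP := nb (\det M ^+ km); apply.
by rewrite exprAC detp -exprM mulnC kE mulnC exprD exprM bp expr1n mul1r expr1.
Qed.

(** [X^p] is a zero of the product of all [t - z^i]; the factors with [i > 0] are invertible at
    [X^p] and cancel. *)
Lemma det1_exp_prime (F : finFieldType) k (X : 'M[F]_k.+1) (z : F) :
  prime k.+1 -> odd k.+1 -> k.+1.-primitive_root z ->
  (k.+1 %| #|F|.-1)%N -> ~~ (k.+1 ^ 2 %| #|F|.-1)%N ->
  \det X = 1 -> X ^+ (k.+1 * k.+1) = 1 -> X ^+ k.+1 = 1.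
Proof.
set p := k.+1 => pr_p odd_p prim_z dvp ndvp detX Xpp.
have unitf i : (0 < i < p)%N -> X ^+ p - (z ^+ i)%:M \is a GRing.unit.
  move=> /andP[i0 ip]; set b := z ^+ i.
  have prim_b : p.-primitive_root b.
    by rewrite prim_root_exp_coprime // coprime_sym prime_coprime // gtnNdvd.
  have irr : irreducible_poly ('X^p - b%:P).
    apply: irreducible_Xn_sub_C => // [|c]; first exact: prim_expr_order.
    exact: prim_root_not_power prim_b dvp ndvp.
  have: coprimep ('X^p - b%:P) (char_poly X).
    rewrite irreducible_poly_coprime //; apply/negP=> dv.
    have: 'X^p - b%:P %= char_poly X.
      by rewrite -dvdp_size_eqp // size_XnsubC ?size_char_poly.
    (* Constant coefficients give [- b = (-1)^p det X = -1], against the primitivity of [b]. *)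
    rewrite eqp_monic ?char_poly_monic ?monicXnsubC // => /eqP/(congr1 (fun q : {poly F} => q`_0)).
    rewrite char_poly_det detX mulr1 -signr_odd odd_p coefB coefXn coefC /= sub0r.
    move/oppr_inj/eqP; apply/negP; have := prim_order_dvd prim_b 1.
    by rewrite expr1 => <-; rewrite dvdn1 gtn_eqF // prime_gt1.
  (* At [X] the Bezout relation loses its second term by Cayley-Hamilton and shows the factor to be
     invertible. *)
  case/Bezout_coprimepP=> [[u v]] /=; rewrite -size_poly_eq1.
  move/size_poly1P=> [c c0 /(congr1 (horner_mx X))].
  rewrite rmorphD !rmorphM /= Cayley_Hamilton mulr0 addr0 rmorphB /= rmorphXn /=.
  rewrite horner_mx_X !horner_mx_C => uX.
  have: c%:M \in @unitmx F k.+1 by rewrite unitmxE det_scalar unitrX ?unitfE.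
  by rewrite -uX unitmx_mul => /andP[].
have: \prod_(0 <= i < p) (X ^+ p - (z ^+ i)%:M) = 0.
  have := congr1 (horner_mx (X ^+ p)) (factor_Xn_sub_1 prim_z).
  rewrite rmorph_prod rmorphB /= rmorphXn /= rmorph1 horner_mx_X -exprM Xpp subrr.
  by under eq_bigr do rewrite rmorphB /= horner_mx_X horner_mx_C.
rewrite big_nat_recl // expr0 => /(congr1 (fun A => A *
   (\prod_(0 <= i < k) (X ^+ p - (z ^+ i.+1)%:M))^-1)).
rewrite mul0r mulrK; first by move/eqP; rewrite subr_eq0 => /eqP.
rewrite big_seq; apply: GRing.unitr_prod => i; rewrite mem_index_iota => /andP[_ ik].
exact: unitf.
Qed.

Lemma det1_exp_4 (F : fieldType) (X : 'M[F]_2) :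
  (forall t : F, t ^+ 2 != 2%:R) -> \det X = 1 -> X ^+ 8 = 1 -> X ^+ 4 = 1.
Proof.
move=> sq2 detX X8; pose t := \tr X.
have chX : char_poly X = 'X^2 - t *: 'X + 1.
  apply/polyP=> i; rewrite !coefD coefN coefZ coefXn coefX coef1.
  case: i => [|[|[|i]]] /=.
  - by rewrite char_poly_det detX sqrrN expr1n mulr1 mulr0 subr0 add0r.
  - by rewrite (char_poly_trace X) // mulr1 add0r addr0.
  - have := char_poly_monic X; rewrite monicE lead_coefE size_char_poly => /eqP->.
    by rewrite mulr0 subr0 addr0.
  - by rewrite nth_default ?size_char_poly // mulr0 subr0 addr0.
have X4 : X ^+ 4 + 1 = (t ^+ 2 - 2%:R) *: X ^+ 2.
  (* The last product is [('X^2 + 1)^2 - t^2 'X^2]; it vanishes at [X] by Cayley-Hamilton. *)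
  have E : 'X^4 + 1 = (t ^+ 2 - 2%:R) *: 'X^2 + ('X^2 + t *: 'X + 1) * char_poly X.
    by rewrite chX -!mul_polyC; ring.
  have := congr1 (horner_mx X) E.
  rewrite !rmorphD !rmorphM /= Cayley_Hamilton mulr0 addr0 linearZ /=.
  by rewrite !rmorphXn /= rmorph1 horner_mx_X.
have uX : X \is a GRing.unit by apply: (eqP); rewrite unitmxE detX unitr1.
have u4 : X ^+ 4 + 1 \is a GRing.unit.
  by rewrite X4 scaler_unit ?unitrX // unitfE subr_eq0.
have: (X ^+ 4 - 1) * (X ^+ 4 + 1) = 0.
  by rewrite mulrDr mulr1 mulrBl mul1r -exprD X8 addrA subrK subrr.
by move/(congr1 (fun A => A / (X ^+ 4 + 1))); rewrite mul0r mulrK // => /eqP;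
  rewrite subr_eq0 => /eqP.
Qed.

(** * Choice of the finite field *)

(** Supplies the scalar [a] needed for perfectness: only 0, 1 and -1 are excluded. *)
Lemma exists_sqr_neq1 (F : finFieldType) : (3 < #|F|)%N ->
  exists a : F, a != 0 /\ a ^+ 2 != 1.
Proof.
move=> F3; have: ~~ ([set: F] \subset [set 0; 1; -1]).
  apply: contraL F3 => /subset_leq_card; rewrite cardsT -leqNgt => /leq_trans; apply.
  by rewrite setUC cardsU1 cards2; apply: (@leq_add _ _ 1 2); rewrite ?ltnS leq_b1.
case/subsetPn=> a _; rewrite !inE !negb_or => /andP[/andP[a0 a1] aN1].
by exists a; rewrite sqrf_eq1 negb_or a0 a1.
Qed.

Lemma exists_prim_root_prime (F : finFieldType) p :
  prime p -> (p %| #|F|.-1)%N -> exists z : F, p.-primitive_root z.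
Proof.
move=> pr_p; rewrite -card_finField_unit => /(Cauchy pr_p)[u _ ou].
have: val u ^+ p = 1.
  by rewrite -FinRing.val_unitX -ou expg_order.
case/(prim_order_exists (prime_gt0 pr_p))=> r prim_r rp; exists (val u).
have [_ /(_ r rp)/orP[/eqP r1|/eqP<-//]] := primeP pr_p.
have u1 : u = 1%g.
  by apply: val_inj; have := prim_expr_order prim_r; rewrite r1 expr1.
by move: ou pr_p; rewrite u1 order1 => <-.
Qed.

(** The first two terms of the binomial expansion. *)
Lemma expn_succ_modn_sqr p n : (p.+1 ^ n = n * p + 1 %[mod p ^ 2])%N.
Proof.
elim: n => // n IHn; rewrite expnS -modnMmr IHn modnMmr.
have -> : (p.+1 * (n * p + 1) = n * p ^ 2 + (n.+1 * p + 1))%N by lia.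
by rewrite modnMDl.
Qed.

(* (p+1)^(p-1) = 1 - p mod p^2, so some prime divisor r of p + 1 works. *)
Lemma exists_prime_expn_pred_neq1 p : prime p -> odd p ->
  exists r, [/\ prime r, coprime r p & (r ^ p.-1 != 1 %[mod p ^ 2])%N].
Proof.
move=> pr_p odd_p; have p1 := prime_gt1 pr_p.
(* The congruence is multiplicative, so it passes from the prime divisors of [m] to [m]. *)
have mulP m : (0 < m)%N ->
    (forall r, prime r -> r %| m -> r ^ p.-1 == 1 %[mod p ^ 2])%N ->
    (m ^ p.-1 == 1 %[mod p ^ 2])%N.
  elim/ltn_ind: m => m IHm m0 mP.
  have [->|m1] := eqVneq m 1%N; first by rewrite exp1n.
  have gt1 : (1 < m)%N by rewrite ltn_neqAle eq_sym m1.
  have [s mE] := dvdnP (pdiv_dvd m).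
  have prm := pdiv_prime gt1.
  have s0 : (0 < s)%N by move: m0; rewrite {1}mE muln_gt0 => /andP[].
  rewrite mE expnMn -modnMm.
  rewrite (eqP (mP _ prm (pdiv_dvd m))) (eqP (IHm s _ s0 _)) ?modnMm ?mul1n //.
    by rewrite mE ltn_Pmulr // prime_gt1.
  by move=> r pr_r rs; apply: mP => //; rewrite mE dvdn_mulr.
have /allPn[r] : ~~ all (fun r => r ^ p.-1 == 1 %[mod p ^ 2])%N (primes p.+1).
  apply/negP=> /allP allP1.
  have: (p.+1 ^ p.-1 == 1 %[mod p ^ 2])%N.
    by apply: mulP => // r pr_r rp; apply: allP1; rewrite mem_primes pr_r.
  rewrite expn_succ_modn_sqr eqn_mod_dvd ?addn1 // subn1 /= expnS expn1.
  by rewrite dvdn_pmul2r ?prime_gt0 // gtnNdvd //; lia.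
rewrite mem_primes => /and3P[pr_r _ rp] nr; exists r; split=> //.
rewrite prime_coprime //; apply/negP=> rp'.
have: (r %| 1)%N by rewrite -(dvdn_addr _ rp') addn1.
by rewrite dvdn1 gtn_eqF // prime_gt1.
Qed.

Lemma exists_field_pred_exact_dvd p N : prime p -> odd p ->
  exists F : finFieldType,
    [/\ (N < #|F|)%N, (p %| #|F|.-1)%N & ~~ (p ^ 2 %| #|F|.-1)%N].
Proof.
move=> pr_p odd_p; have [r [pr_r rp nr]] := exists_prime_expn_pred_neq1 pr_p odd_p.
have p1 := prime_gt1 pr_p.
(* Since [e = (p - 1) + phi(p^2) N], [r^e] is 1 mod [p] by Fermat and [r^(p-1)] mod [p^2] by Euler;
   [e > N] makes the field large. *)
pose e := (p.-1 * (p * N).+1)%N.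
have e0 : (0 < e)%N by rewrite muln_gt0 andbT; lia.
have [F _ cardF] := pPrimePowerField pr_r e0.
have cong d : (0 < d)%N -> (d %| #|F|.-1)%N = (r ^ e == 1 %[mod d])%N.
  by move=> d0; rewrite cardF eqn_mod_dvd ?subn1 // expn_gt0 prime_gt0.
have eN : (N < e)%N.
  apply: (@leq_trans (p * N).+1); first by rewrite ltnS leq_pmull // ltnW.
  by rewrite leq_pmull // -ltnS prednK // ltnW.
exists F; split.
- by rewrite cardF (ltn_trans eN) // ltn_expl // prime_gt1.
- rewrite cong ?prime_gt0 // /e expnM -modnXm -{1}(totient_prime pr_p).
  by rewrite Euler_exp_totient // modnXm exp1n.
rewrite cong ?expn_gt0 ?prime_gt0 //.
have -> : e = (p.-1 + totient (p ^ 2) * N)%N.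
  by rewrite totient_pfactor // expn1 /e mulnS mulnA.
rewrite expnD expnM -modnMmr -[X in (_ * X)%N]modnXm.
rewrite Euler_exp_totient ?coprimeXr //.
by rewrite modnXm exp1n modnMmr muln1.
Qed.

(** In characteristic 3 one has [2 = -1], and -1 is not a square when [|F|], an odd power of 3, is 3
    mod 4. *)
Lemma exists_field_2_nonsquare N :
  exists F : finFieldType,
    [/\ (N < #|F|)%N, -1 != 1 :> F & forall t : F, t ^+ 2 != 2%:R].
Proof.
have [F char3 cardF] := @pPrimePowerField 3 (N.*2.+3) isT isT.
have three0 : 3%:R = 0 :> F by rewrite (pcharf0 char3).
have two : 2%:R = -1 :> F.
  by apply/eqP; rewrite -subr_eq0 opprK -mulrSr three0.
have N11 : -1 != 1 :> F.
  by rewrite eq_sym -subr_eq0 opprK -mulr2n two oppr_eq0 oner_eq0.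
have [j cardE] : exists j, #|F|.-1 = (4 * j + 2)%N.
  exists (#|F|.-1 %/ 4)%N; rewrite {1}(divn_eq #|F|.-1 4) mulnC; congr (_ + _)%N.
  have ->: #|F|.-1 = (9 ^ N.+1 * 3 - 1)%N.
    by rewrite cardF -(expnM 3 2) -expnSr subn1; congr (3 ^ _).-1; lia.
  have : (9 ^ N.+1 = 1 %[mod 4])%N by rewrite -modnXm exp1n.
  lia.
exists F; split=> // [|t].
  by rewrite cardF (leq_trans _ (ltnW (ltn_expl _ _))) //; lia.
rewrite two; apply/eqP=> t2.
have t0 : t != 0.
  by apply: contra_eqN t2 => /eqP->; rewrite expr0n eq_sym oppr_eq0 oner_eq0.
have F0 : (0 < #|F|)%N by rewrite -cardsT (cardD1 0) inE.
have: t ^+ #|F|.-1 = 1.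
  by apply: (mulIf t0); rewrite -exprSr prednK // expf_card mul1r.
rewrite cardE exprD (exprM _ 4) (exprM t 2 2) t2 sqrrN !expr1n mul1r => /eqP.
by rewrite (negPf N11).
Qed.

(** * Proof of the theorem *)

(** Serves both cases: [d = p] in odd prime dimension [p], and [p = 2], [d = 4] in dimension 2. The
    scalar matrix of [z] is the central p-element that is missed. *)
Lemma power_map_transvection_group (F : finFieldType) k p d n (z : F) :
  prime p -> z ^+ k.+2 = 1 -> z ^+ p = 1 -> z != 1 -> (3 < #|F|)%N ->
  (forall X : 'M[F]_k.+2, \det X = 1 -> X ^+ (p * d) = 1 -> X ^+ d = 1) ->
  (d %| n)%N ->
  quasisimple (transvection_group F k) /\
  ~ power_map_surjective (transvection_group F k) n.
Proof.
move=> pr_p zm zp z1 /exists_sqr_neq1[a [a0 a1]] step dn.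
split; first exact: transvection_group_quasisimple a0 a1.
have matX (g : {'GL_(k.+2)[F]}) r : matrix_of (g ^+ r)%g = matrix_of g ^+ r.
  by elim: r => // r IHr; rewrite expgS exprS matrix_ofM IHr.
have [g gG gE] := in_group_scalar zm.
apply: (@power_map_not_surjective _ _ p d n g) => //.
- apply: p_elt_expg_eq1 => x xG /(congr1 (@matrix_of F k)).
  rewrite matX matrix_of1 => /(step _ (det_transvection_group a0 a1 xG)) xd.
  by apply: matrix_of_inj; rewrite matX xd matrix_of1.
- exact: scalar_central gE.
- apply: (@pnat_dvd _ p); last exact: pnat_id.
  rewrite order_dvdn; apply/eqP/matrix_of_inj.
  by rewrite matX gE -rmorphXn /= zp.
- apply: contraNneq z1 => g1; move: gE; rewrite g1 matrix_of1.
  by move/matrixP/(_ 0 0); rewrite !mxE eqxx !mulr1n => <-.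
Qed.

Local Close Scope ring_scope.

Theorem corollary4p3 (n : nat) (hn : 2 < n) :
  forall N : nat, exists (gT : finGroupType) (G : {group gT}),
    [/\ quasisimple G, N < #|G| & ~ power_map_surjective G n].
Proof.
move=> N; have [dn|nd] := boolP (4 %| n).
  have [F [ltN N11 sq2]] := exists_field_2_nonsquare (maxn N 3).
  have /andP[ltNF lt3F] : (N < #|F|) && (3 < #|F|) by rewrite -gtn_max.
  have m1sq : ((-1) ^+ 2 = 1 :> F)%R by rewrite sqrrN expr1n.
  exists {'GL_2[F]}, (transvection_group F 0).
  have step X := @det1_exp_4 F X sq2.
  have [qs nsurj] := @power_map_transvection_group F 0 2 4 n (-1)%R
    isT m1sq m1sq N11 lt3F step dn.
  split=> //; apply: leq_trans ltNF _; exact: card_transvection_group.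
(* As 4 does not divide [n] and [n > 2], [r] is odd and greater than 1, so it has an odd prime
   divisor. *)
pose r := if odd n then n else n./2.
have rn : r %| n.
  rewrite /r; case: ifP => // evn.
  by rewrite -{2}(odd_double_half n) evn add0n -muln2 dvdn_mulr.
have odd_r : odd r by rewrite /r; case: ifP => //; lia.
have r1 : 1 < r by rewrite /r; case: ifP => //; lia.
have pr_p := pdiv_prime r1; have pr := pdiv_dvd r.
have odd_p := dvdn_odd pr odd_r.
move: (pdiv r) pr_p odd_p (dvdn_trans pr rn) => [|[|k]] // pr_p odd_p pn.
have [F [ltN dvF ndvF]] := exists_field_pred_exact_dvd (maxn N 3) pr_p odd_p.
have /andP[ltNF lt3F] : (N < #|F|) && (3 < #|F|) by rewrite -gtn_max.
have [z prim_z] := exists_prim_root_prime pr_p dvF.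
have zp := prim_expr_order prim_z.
exists {'GL_k.+2[F]}, (transvection_group F k).
have z1 : (z != 1)%R by rewrite -[z]expr1 -(prim_order_dvd prim_z) dvdn1.
have step X := @det1_exp_prime F k.+1 X z pr_p odd_p prim_z dvF ndvF.
have [qs nsurj] := power_map_transvection_group pr_p zp zp z1 lt3F step pn.
split=> //; apply: leq_trans ltNF _; exact: card_transvection_group.
Qed.
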